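(* Let $d$, $\Delta$, and $s$ be integers with $1\le d\le\Delta$ and $0\le s<\Delta$. Let $G$ be a finite simple $d$-degenerate graph with maximum degree $\Delta(G)\le\Delta$. If $q_B(G)\ge d\Delta-s$, then $G$ contains a copy of $K_{d,\Delta-s}$. If in addition $s<d$, then $G$ also contains a copy of $K_{d-s,\Delta}$.
   Context: A $B$-coloring of a graph $G$ is a proper edge-coloring (incident edges receive distinct colors) in which the edges of every $4$-cycle receive four distinct colors; $q_B(G)$ is the minimum number of colors in a $B$-coloring of $G$. A graph is $d$-degenerate if every nonempty subgraph has a vertex of degree at most $d$ (in that subgraph). ''Contains a copy of $K_{a,b}$'' means contains a subgraph, not necessarily induced, isomorphic to the complete bipartite graph $K_{a,b}$. $\Delta(G)$ denotes the maximum degree of $G$. *)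

(* Defs.v *)
From mathcomp Require Import all_boot.

Set Implicit Arguments.
Unset Strict Implicit.
Unset Printing Implicit Defensive.

Record sgraph := SGraph {
  vertex :> finType;
  adj : rel vertex;
  adj_sym : symmetric adj;
  adj_irrefl : irreflexive adj }.

Definition edge_set (G : sgraph) : {set {set G}} :=
  [set [set p.1; p.2] | p : G * G & adj p.1 p.2].

Definition edge (G : sgraph) := {A : {set G} | A \in edge_set G}.

Definition degree (G : sgraph) (x : G) := #|[set y | adj x y]|.

Definition max_degree (G : sgraph) := \max_(x : G) degree x.

(* [H] is isomorphic to a (not necessarily induced) subgraph of [G], i.e.,
   [G] contains a copy of [H]. *)
Definition subgraph (H G : sgraph) : Prop :=
  exists2 f : H -> G, injective f & {homo f : x y / adj x y}.

(* Degrees are invariant under isomorphism, so it is harmless to quantify over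
   subgraphs up to isomorphism. *)
Definition degenerate (d : nat) (G : sgraph) : Prop :=
  forall H : sgraph, subgraph H G -> 0 < #|H| -> exists x : H, degree x <= d.

Section CompleteBipartite.
Variables a b : nat.

Definition complete_bipartite_adj : rel ('I_a + 'I_b) :=
  fun u v => match u, v with
             | inl _, inr _ | inr _, inl _ => true
             | _, _ => false
             end.

Lemma complete_bipartite_sym : symmetric complete_bipartite_adj.
Proof. by case=> ? [?|?]. Qed.

Lemma complete_bipartite_irrefl : irreflexive complete_bipartite_adj.
Proof. by case. Qed.

Definition complete_bipartite : sgraph :=
  SGraph complete_bipartite_sym complete_bipartite_irrefl.
End CompleteBipartite.

Section BColoring.
Variable G : sgraph.

Definition proper_coloring (k : nat) (c : {ffun edge G -> 'I_k}) : bool :=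
  [forall e1 : edge G, forall e2 : edge G,
    (e1 != e2) && ~~ [disjoint val e1 & val e2] ==> (c e1 != c e2)].

(* [e1, e2, e3, e4] are, in cyclic order, the edges of a 4-cycle. *)
Definition four_cycle (e1 e2 e3 e4 : edge G) : bool :=
  [exists x : G, exists y : G, exists z : G, exists t : G,
    [&& uniq [:: x; y; z; t],
        val e1 == [set x; y], val e2 == [set y; z],
        val e3 == [set z; t] & val e4 == [set t; x]]].

Definition B_coloring (k : nat) (c : {ffun edge G -> 'I_k}) : bool :=
  proper_coloring c &&
  [forall e1 : edge G, forall e2 : edge G, forall e3 : edge G, forall e4 : edge G,
    four_cycle e1 e2 e3 e4 ==> uniq [:: c e1; c e2; c e3; c e4]].

Definition B_colorable (k : nat) : bool :=
  [exists c : {ffun edge G -> 'I_k}, B_coloring c].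

Lemma four_cycle_uniq (e1 e2 e3 e4 : edge G) :
  four_cycle e1 e2 e3 e4 -> uniq [:: e1; e2; e3; e4].
Proof.
case/existsP=> x /existsP[y] /existsP[z] /existsP[t].
case/and5P=> /= U /eqP h1 /eqP h2 /eqP h3 /eqP h4.
move: U; rewrite !inE !negb_or !andbT -!val_eqE /= h1 h2 h3 h4.
case/and3P=> /and3P[xy xz xt] /andP[yz yt] zt.
have neq (A B : {set G}) u : u \in A -> u \notin B -> A != B.
  by move=> uA; apply: contraNneq => <-.
apply/and3P; split.
- apply/and3P; split.
  + by apply: (neq _ _ x); rewrite !inE ?eqxx // negb_or xy.
  + by apply: (neq _ _ x); rewrite !inE ?eqxx // negb_or xz.
  + by apply: (neq _ _ y); rewrite !inE ?eqxx ?orbT // negb_or yt eq_sym.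
- apply/andP; split.
  + by apply: (neq _ _ y); rewrite !inE ?eqxx // negb_or yz.
  + by apply: (neq _ _ y); rewrite !inE ?eqxx // negb_or yt eq_sym.
- by apply: (neq _ _ z); rewrite !inE ?eqxx // negb_or zt eq_sym.
Qed.

Lemma B_colorable_ex : exists k, B_colorable k.
Proof.
exists #|{: edge G}|; apply/existsP; exists [ffun e => enum_rank e].
apply/andP; split.
  apply/forallP=> e1; apply/forallP=> e2; apply/implyP=> /andP[ne _].
  by rewrite !ffunE (inj_eq enum_rank_inj).
apply/forallP=> e1; apply/forallP=> e2; apply/forallP=> e3; apply/forallP=> e4.
apply/implyP=> /four_cycle_uniq; rewrite !ffunE.
by rewrite -(map_inj_uniq (@enum_rank_inj _)).
Qed.

Definition q_B : nat := ex_minn B_colorable_ex.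
End BColoring.

(* Main.v *)
Require Import Defs.
From mathcomp Require Import all_boot.
From mathcomp Require Import zify.

(** Two edges conflict when they share a vertex or are opposite in a 4-cycle; a
B-coloring is a coloring of the conflict graph.  Given a nonempty set of edges,
let S be the set of their endpoints, v a vertex of S with at most d neighbors in
S, U the set of these neighbors, and uv an edge of the given set.  An edge
inside S conflicting with uv has the form wz with w in U, z adjacent to both u
and w, and (w, z) <> (u, v); so uv has fewer than \sum_(w in U) |N(u) :&: N(w)|
conflicts.  If this sum is always less than d * Delta - s, then greedy coloring
uses d * Delta - s - 1 colors.  Otherwise |U| = d and the deficits
Delta - |N(u) :&: N(w)| sum up to at most s, which gives both bipartite
graphs. *)

Set Implicit Arguments.
Unset Strict Implicit.
Unset Printing Implicit Defensive.

(** * Greedy coloring of a finite graph *)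

Lemma greedy_coloring (T : finType) (r : rel T) (k : nat) :
    symmetric r ->
    (forall A : {set T}, A != set0 ->
       exists2 x, x \in A & #|[set y in A | (y != x) && r x y]| < k) ->
  exists c : {ffun T -> 'I_k}, forall x y, x != y -> r x y -> c x != c y.
Proof.
move=> r_sym low.
(* Induction over subsets; colors in [nat] let the empty set be colored even when [k = 0]. *)
suff [c ltc cP] : exists2 c : T -> nat, forall x, x \in [set: T] -> c x < k
    & {in [set: T] &, forall x y, x != y -> r x y -> c x != c y}.
  exists [ffun x => Ordinal (ltc x (in_setT x))] => x y ne rxy.
  by rewrite !ffunE -val_eqE /=; apply: cP; rewrite ?inE.
have [n] := ubnP #|[set: T]|; elim: n [set: T] => // n IH A.
rewrite ltnS => leAn.
have [->|/low[x xA few]] := eqVneq A set0.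
  by exists (fun=> 0) => [x|x y]; rewrite inE.
have [|c ltc cP] := IH (A :\ x); first by rewrite (cardsD1 x A) xA in leAn.
pose N := [set y in A | (y != x) && r x y].
(* Pigeonhole: the fewer than [k] elements of [N] cannot use every color. *)
have [i iN] : exists i : 'I_k, val i \notin [seq c y | y in N].
  apply/existsP; apply: contraT; rewrite negb_exists => /forallP all_used.
  have: size (map val (enum 'I_k)) <= size [seq c y | y in N].
    apply: uniq_leq_size; first by rewrite map_inj_uniq ?enum_uniq //; apply: val_inj.
    by move=> _ /mapP[i _ ->]; have:= all_used i; rewrite negbK.
  by rewrite size_map size_enum_ord size_image leqNgt few.
have fresh y : y \in A -> y != x -> r x y -> c y != i.
  move=> yA yx rxy; apply: contraNneq iN => /= <-.
  by apply: image_f; rewrite !inE yA yx.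
exists (fun y => if y == x then val i else c y) => [y yA|y z yA zA].
  by have [_|yx] := eqVneq y x; [apply: ltn_ord | apply: ltc; rewrite !inE yx].
have [->|yx] := eqVneq y x; have [->|zx] := eqVneq z x; rewrite ?eqxx //.
- by move=> _ rxz; rewrite eq_sym fresh.
- by move=> _ ryx; rewrite fresh // r_sym.
- by apply: cP; rewrite !inE ?yx ?zx.
Qed.

Lemma set2_inj (T : finType) (a b x y : T) :
  [set a; b] = [set x; y] -> (a = x /\ b = y) \/ (a = y /\ b = x).
Proof.
move/setP=> eq_xy.
have := eq_xy a; have := eq_xy b; have := eq_xy x; have := eq_xy y.
rewrite !inE !eqxx !orbT /= => /orP hy /orP hx /esym/orP hb /esym/orP ha.
by case: ha hb hx hy => /eqP ? [] /eqP ? [] /eqP ? [] /eqP ?; subst; auto.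
Qed.

(** * Edges, 4-cycles and conflicts *)

Section Graph.
Variable G : sgraph.
Implicit Types (x y z u v w : G) (e f : edge G).

Definition neighbors x := [set y | adj x y].

Lemma in_neighbors x y : (y \in neighbors x) = adj x y.
Proof. by rewrite inE. Qed.

Lemma degree_le_max x : degree x <= max_degree G.
Proof. exact: leq_bigmax. Qed.

Lemma set2_edge x y : ([set x; y] \in edge_set G) = adj x y.
Proof.
apply/imsetP/idP=> [[[a b] /=]|xy]; last by exists (x, y); rewrite ?inE.
by rewrite inE /= => ab /set2_inj[] [-> ->] //; rewrite adj_sym.
Qed.

Lemma edge_set2 e x : x \in val e -> exists2 y, adj x y & val e = [set x; y].
Proof.
case/imsetP: (valP e) => -[a b] /=; rewrite inE /= => ab ->.
rewrite !inE => /orP[] /eqP->; first by exists b.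
by exists a; rewrite 1?adj_sym // setUC.
Qed.

Lemma four_cycle_rot (e1 e2 e3 e4 : edge G) :
  four_cycle e1 e2 e3 e4 -> four_cycle e2 e3 e4 e1.
Proof.
case/existsP=> x /existsP[y] /existsP[z] /existsP[t] /and5P[U h1 h2 h3 h4].
apply/existsP; exists y; apply/existsP; exists z; apply/existsP; exists t.
apply/existsP; exists x; apply/and5P; split=> //.
by rewrite -(rot_uniq 1) in U.
Qed.

Definition conflict e f :=
  ~~ [disjoint val e & val f] || [exists g, exists h, four_cycle e g f h].

(** Rotating a 4-cycle twice exchanges opposite edges. *)
Lemma conflict_sym : symmetric conflict.
Proof.
move=> e f; rewrite /conflict disjoint_sym; congr (_ || _).
by apply/existsP/existsP=> -[g] /existsP[h] /four_cycle_rot/four_cycle_rot C;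
  exists h; apply/existsP; exists g.
Qed.

Lemma conflict_coloring k (c : {ffun edge G -> 'I_k}) :
  (forall e f, e != f -> conflict e f -> c e != c f) -> B_coloring c.
Proof.
move=> cP; apply/andP; split.
  apply/forallP=> e; apply/forallP=> f; apply/implyP=> /andP[ne nd].
  by apply: cP => //; rewrite /conflict nd.
apply/forallP=> e1; apply/forallP=> e2; apply/forallP=> e3; apply/forallP=> e4.
apply/implyP=> C1.
have adjC (f1 f2 f3 f4 : edge G) : four_cycle f1 f2 f3 f4 -> c f1 != c f2.
  move=> C; apply: cP.
    by have := four_cycle_uniq C; rewrite /= !inE; case: eqP.
  case/existsP: C => x /existsP[y] /existsP[z] /existsP[t].
  case/and5P=> _ /eqP h1 /eqP h2 _ _; apply/orP; left.
  by apply/pred0Pn; exists y; rewrite /= h1 h2 !inE eqxx orbT.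
have oppC (f1 f2 f3 f4 : edge G) : four_cycle f1 f2 f3 f4 -> c f1 != c f3.
  move=> C; apply: cP.
    by have := four_cycle_uniq C; rewrite /= !inE; case: (f1 =P f3); rewrite ?orbT.
  by apply/orP; right; apply/existsP; exists f2; apply/existsP; exists f4.
(* Rotations bring each of the six pairs of edges into first-second or first-third position. *)
have C2 := four_cycle_rot C1; have C3 := four_cycle_rot C2.
have C4 := four_cycle_rot C3.
rewrite /= !inE !negb_or (adjC _ _ _ _ C1) (oppC _ _ _ _ C1) (adjC _ _ _ _ C2).
by rewrite (oppC _ _ _ _ C2) (adjC _ _ _ _ C3) eq_sym (adjC _ _ _ _ C4).
Qed.

Lemma q_B_le k (c : {ffun edge G -> 'I_k}) : B_coloring c -> q_B G <= k.
Proof.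
move=> cP; rewrite /q_B; case: ex_minnP => m _; apply.
by apply/existsP; exists c.
Qed.

Lemma conflict_count (S : {set G}) (A : {set edge G}) e u v :
    (forall f, f \in A -> val f \subset S) ->
    e \in A -> val e = [set v; u] ->
  #|[set f in A | (f != e) && conflict e f]|
    < \sum_(w in neighbors v :&: S) #|neighbors u :&: neighbors w|.
Proof.
move=> AS eA ee; set C := [set f in A | _]; set U := neighbors v :&: S.
have vu : adj v u by rewrite -set2_edge -ee; apply: valP.
have uS : u \in S by apply: (subsetP (AS e eA)); rewrite ee !inE eqxx orbT.
pose P := [set p : G * G | (p.1 \in U) && (p.2 \in neighbors u :&: neighbors p.1)].
have uvP : (u, v) \in P by rewrite !inE /= vu uS [adj u v]adj_sym vu.
have cardP : #|P| = \sum_(w in U) #|neighbors u :&: neighbors w|.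
  rewrite -sum1_card (eq_bigr (fun w => \sum_(z in neighbors u :&: neighbors w) 1));
    last by move=> w _; rewrite sum1_card.
  by rewrite pair_big_dep /=; apply: eq_bigl => p; rewrite inE.
(* The pair [(u, v)] encodes [e] itself; discarding it makes the inequality strict. Every
   conflicting edge is the unordered version of some remaining pair. *)
rewrite -cardP (cardsD1 (u, v) P) uvP add1n ltnS -(card_imset _ val_inj).
apply: leq_trans (leq_imset_card (fun p : G * G => [set p.1; p.2]) _).
apply/subset_leq_card/subsetP=> _ /imsetP[f + ->].
rewrite inE => /andP[fA /andP[ne cf]].
(* A walk v, w, z, u covers all conflicts: [z = v] if [f] meets [e] at [v], [w = u] if it meets [e]
   at [u], and the rest of the 4-cycle if the edges are opposite. *)
suff [w [z [ff vw uz]]] : exists w z, [/\ val f = [set w; z], adj v w & adj u z].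
  apply/imsetP; exists (w, z) => //=.
  have wS : w \in S by apply: (subsetP (AS f fA)); rewrite ff !inE eqxx.
  have wz : adj w z by rewrite -set2_edge -ff; apply: valP.
  rewrite !inE /= vw wS uz wz !andbT.
  apply: contraNneq ne => -[wu zv]; rewrite -val_eqE /=.
  by rewrite ff ee wu zv setUC.
case/orP: cf => [/pred0Pn[x /andP[/= xe xf]]|].
  have [y xy ->] := edge_set2 xf.
  move: xe; rewrite ee !inE => /orP[] /eqP ?; subst x.
    by exists y, v; rewrite setUC; split=> //; rewrite adj_sym.
  by exists u, y.
case/existsP=> g /existsP[h] /existsP[x] /existsP[y] /existsP[z] /existsP[t].
case/and5P=> _ /eqP h1 /eqP h2 /eqP h3 /eqP h4.
have yz : adj y z by rewrite -set2_edge -h2; apply: valP.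
have tx : adj t x by rewrite -set2_edge -h4; apply: valP.
move: h1; rewrite ee => /set2_inj[] [? ?]; subst x y.
  by exists t, z; rewrite h3 setUC; split=> //; rewrite adj_sym.
by exists z, t; rewrite h3; split=> //; rewrite adj_sym.
Qed.

(** Degeneracy is applied to the subgraph induced on [S], built on the subtype of its elements. *)
Lemma degenerate_induced d (S : {set G}) : degenerate d G -> S != set0 ->
  exists2 v, v \in S & #|neighbors v :&: S| <= d.
Proof.
move=> deg /set0Pn[x0 x0S].
pose T : finType := {x | x \in S}.
pose r : rel T := relpre val (@adj G).
have rs : symmetric r by move=> x y; apply: adj_sym.
have ri : irreflexive r by move=> x; apply: adj_irrefl.
have [||v dv] := deg (SGraph rs ri).
- by exists val => //; apply: val_inj.
- by apply/card_gt0P; exists (Sub x0 x0S : T).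
exists (val v); first exact: valP.
apply: leq_trans dv; rewrite /degree -(card_imset _ val_inj).
apply/subset_leq_card/subsetP=> y; rewrite !inE => /andP[vy yS].
by apply/imsetP; exists (Sub y yS : T); rewrite ?inE.
Qed.

Lemma complete_bipartite_subgraph a b (A B : {set G}) :
    a <= #|A| -> b <= #|B| -> {in A & B, forall x y, adj x y} ->
  subgraph (complete_bipartite a b) G.
Proof.
move=> leA leB AB.
pose h (u : 'I_a + 'I_b) : G := match u with
  | inl i => enum_val (widen_ord leA i)
  | inr j => enum_val (widen_ord leB j) end.
have hAB i j : adj (h (inl i)) (h (inr j)) by apply: AB; apply: enum_valP.
exists h => [|[i|i] [j|j] //= _]; last by rewrite adj_sym; apply: hAB.
  (* [A] and [B] are disjoint, since a common vertex would be adjacent to itself. *)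
  have neq i j : h (inl i) <> h (inr j).
    by move=> hij; have := hAB i j; rewrite hij adj_irrefl.
  case=> i [] j.
  - by move/enum_val_inj/(congr1 val) => /= ?; congr inl; apply: val_inj.
  - by move/neq.
  - by move/esym/neq.
  - by move/enum_val_inj/(congr1 val) => /= ?; congr inr; apply: val_inj.
exact: hAB.
Qed.

(** * Bipartite subgraphs from large common neighborhoods *)

Section CommonNeighbors.
Variables (d Delta s : nat) (U : {set G}) (u : G).
Hypotheses (sD : s < Delta) (maxD : forall x, #|neighbors x| <= Delta).
Hypotheses (uU : u \in U) (cardU : #|U| <= d).
Let a w := #|neighbors u :&: neighbors w|.
Hypothesis sum_a : d * Delta - s <= \sum_(w in U) a w.

Let a_le w : a w <= #|neighbors u|.
Proof. exact/subset_leq_card/subsetIl. Qed.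

Let a_leD w : a w <= Delta.
Proof. exact: leq_trans (a_le w) (maxD u). Qed.

Let sum_aD : \sum_(w in U) a w + \sum_(w in U) (Delta - a w) = #|U| * Delta.
Proof.
by rewrite -big_split -sum_nat_const; apply: eq_bigr => w _ /=; rewrite subnKC.
Qed.

(** With fewer than [d] terms, each at most [Delta], the sum would be at most [d * Delta - Delta],
    which is too small as [s < Delta]. *)
Let cardUd : #|U| = d.
Proof.
apply/eqP; rewrite eqn_leq cardU leqNgt; apply/negP => ltU.
have : #|U|.+1 * Delta <= d * Delta by rewrite leq_mul2r ltU orbT.
by rewrite mulSn; lia.
Qed.

Let deficit : \sum_(w in U) (Delta - a w) <= s.
Proof. by have := sum_aD; rewrite cardUd; lia. Qed.

(** Each [w] in [U] other than [u] excludes at most [Delta - a w] vertices of [neighbors u], which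
    itself falls short of [Delta] by the deficit of [u]. The total loss is at most [s]. *)
Lemma common_neighbors_d : subgraph (complete_bipartite d (Delta - s)) G.
Proof.
pose B := [set z | [forall w in U, adj w z]].
apply: (@complete_bipartite_subgraph _ _ U B); rewrite ?cardUd //; last first.
  by move=> w z wU; rewrite inE => /forall_inP/(_ w wU).
have cover : neighbors u \subset
    B :|: \bigcup_(w in U :\ u) (neighbors u :\: neighbors w).
  apply/subsetP=> z uz; rewrite in_setU.
  have [//|/=] := boolP (z \in B).
  rewrite inE negb_forall_in => /exists_inP[w wU wz].
  apply/bigcupP; exists w; last by rewrite !inE wz -in_neighbors.
  by rewrite !inE wU andbT; apply: contraNneq wz => ->; rewrite -in_neighbors.
have {cover} := subset_leq_card cover.
move/leq_trans/(_ (leq_card_setU _ _)).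
have : #|\bigcup_(w in U :\ u) (neighbors u :\: neighbors w)|
    <= \sum_(w in U :\ u) (Delta - a w).
  elim/big_ind2: _ => [|A m B' n lA lB|w _]; first by rewrite cards0.
    exact: leq_trans (leq_card_setU _ _) (leq_add lA lB).
  by rewrite cardsD; have := maxD u; rewrite -/(a w); lia.
move: deficit; rewrite (big_setD1 u) //= /a setIid.
have := maxD u; lia.
Qed.

Lemma common_neighbors_Delta :
  s < d -> subgraph (complete_bipartite (d - s) Delta) G.
Proof.
move=> sd.
(* Otherwise all [d] deficits are positive and their sum exceeds [s]. *)
have du : #|neighbors u| = Delta.
  apply/eqP; rewrite eqn_leq maxD leqNgt; apply/negP => ltu.
  suff : #|U| <= \sum_(w in U) (Delta - a w) by have := deficit; lia.
  rewrite -sum1_card; apply: leq_sum => w _.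
  by rewrite subn_gt0; apply: leq_ltn_trans (a_le w) ltu.
(* Vertices of deficit zero are adjacent to all of [neighbors u]; at most [s] vertices of [U] have a
   positive deficit. *)
pose A := [set w in U | a w == Delta].
apply: (@complete_bipartite_subgraph _ _ A (neighbors u)); rewrite ?du //.
  have : #|U :\: A| <= \sum_(w in U) (Delta - a w).
    rewrite -sum1_card [leqRHS](big_setID (U :\: A)) /=.
    rewrite (setIidPr (subsetDl _ _)); apply: leq_trans (leq_addr _ _).
    apply: leq_sum => w; rewrite !inE => /andP[+ wU]; rewrite wU /= => ne.
    by rewrite subn_gt0 ltn_neqAle ne a_leD.
  have AU : U :&: A = A by apply/setIidPr/subsetP=> w; rewrite inE => /andP[].
  by rewrite cardsD AU cardUd; have := deficit; lia.
move=> w z; rewrite inE => /andP[_ /eqP aw] uz; rewrite -in_neighbors.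
have /setIidPl/subsetP : neighbors u :&: neighbors w = neighbors u.
  by apply/eqP; rewrite eqEcard subsetIl /= du -/(a w) aw.
exact.
Qed.

End CommonNeighbors.
End Graph.

Theorem theorem1p2 (d Delta s : nat) (G : sgraph)
    (hd1 : 1 <= d) (hdD : d <= Delta) (hsD : s < Delta)
    (hdeg : degenerate d G) (hmax : max_degree G <= Delta)
    (hq : d * Delta - s <= q_B G) :
  subgraph (complete_bipartite d (Delta - s)) G /\
  (s < d -> subgraph (complete_bipartite (d - s) Delta) G).
Proof.
have maxD (x : G) : #|neighbors x| <= Delta := leq_trans (degree_le_max x) hmax.
pose heavy (u : G) (U : {set G}) := [&& u \in U, #|U| <= d &
  d * Delta - s <= \sum_(w in U) #|neighbors u :&: neighbors w|].
have [/existsP[u /existsP[U /and3P[uU cU sU]]]|light] :=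
    boolP [exists u, exists U, heavy u U].
  by split; [apply: common_neighbors_d sU | apply: common_neighbors_Delta sU].
(* Positivity makes the predecessor a truly smaller number of colors, contradicting [hq]. *)
have pos : 0 < d * Delta - s.
  by rewrite subn_gt0 (leq_trans hsD) // leq_pmull.
suff [c /conflict_coloring/q_B_le] :
    exists c : {ffun edge G -> 'I_(d * Delta - s).-1},
      forall e f, e != f -> conflict e f -> c e != c f by lia.
apply: greedy_coloring => [|A /set0Pn[e0 e0A]]; first exact: conflict_sym.
pose S := \bigcup_(e in A) val e.
have AS e : e \in A -> val e \subset S by move=> eA; apply: bigcup_sup eA.
have S0 : S != set0.
  have /imsetP[[x y] _ ee] := valP e0; apply/set0Pn; exists x.
  by apply: (subsetP (AS _ e0A)); rewrite ee !inE eqxx.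
have [v /bigcupP[e eA ve] cU] := degenerate_induced hdeg S0.
have [u vu ee] := edge_set2 ve; exists e => //.
have count := conflict_count AS eA ee.
have uS : u \in S by apply: (subsetP (AS _ eA)); rewrite ee !inE eqxx orbT.
move: light; rewrite negb_exists => /forallP/(_ u).
rewrite negb_exists => /forallP/(_ (neighbors v :&: S)).
(* Two strict inequalities combine: conflicts are fewer than the sum, and the sum is below
   [d * Delta - s]; this pays for the predecessor. *)
rewrite /heavy cU !inE vu uS /= -ltnNge ltn_predRL.
exact: leq_ltn_trans count.
Qed.
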